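(* For all complex numbers $u,v,z$ the following hold (in particular the series converge): a) for every integer $q\ge 0$, $$\sum_{p=0}^{+\infty}\frac{u^p}{p!}H_{p,q}(z,\overline{z})=(\overline{z}-u)^q e^{uz};$$ a') for every integer $p\ge 0$, $$\sum_{q=0}^{+\infty}\frac{v^q}{q!}H_{p,q}(z,\overline{z})=(z-v)^p e^{v\overline{z}};$$ b) $$\sum_{p,q=0}^{+\infty}\frac{u^p}{p!}\frac{v^q}{q!}H_{p,q}(z,\overline{z})=e^{uz+v\overline{z}-uv}.$$
   Context: For $z=x+iy\in\mathbb{C}$, $\partial_z=\frac12\left(\frac{\partial}{\partial x}-i\frac{\partial}{\partial y}\right)$ and $\partial_{\overline{z}}=\frac12\left(\frac{\partial}{\partial x}+i\frac{\partial}{\partial y}\right)$. The complex Hermite polynomials are, for integers $p,q\ge 0$, $$H_{p,q}(z,\overline{z})=(-1)^{p+q}e^{z\overline{z}}\,\partial_{\overline{z}}^{p}\partial_z^{q}\left(e^{-z\overline{z}}\right).$$ *)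

(* Defs.v *)
From Stdlib Require Import Reals Factorial List.
From Coquelicot Require Import Coquelicot.

Open Scope C_scope.

Definition Cexp (z : C) : C :=
  (exp (Re z) * cos (Im z), exp (Re z) * sin (Im z))%R.

(** Real partial derivatives of [f : C -> C], taken on the real and imaginary
    parts of [f].  [Derive] is total, so these carry information only where
    the partial derivatives exist. *)
Definition partial_x (f : C -> C) (z : C) : C :=
  (Derive (fun t : R => Re (f (t, Im z))) (Re z),
   Derive (fun t : R => Im (f (t, Im z))) (Re z)).

Definition partial_y (f : C -> C) (z : C) : C :=
  (Derive (fun t : R => Re (f (Re z, t))) (Im z),
   Derive (fun t : R => Im (f (Re z, t))) (Im z)).

Definition partial_z (f : C -> C) (z : C) : C :=
  RtoC (/ 2) * (partial_x f z - Ci * partial_y f z).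

Definition partial_zbar (f : C -> C) (z : C) : C :=
  RtoC (/ 2) * (partial_x f z + Ci * partial_y f z).

(** [Hermite p q z] is H_{p,q}(z, conj z). *)
Definition Hermite (p q : nat) (z : C) : C :=
  RtoC (-1) ^ (p + q) * Cexp (z * Cconj z) *
  Nat.iter p partial_zbar
    (Nat.iter q partial_z (fun w : C => Cexp (- (w * Cconj w)))) z.

Definition is_Cseries (a : nat -> C) (l : C) : Prop :=
  @is_series C_AbsRing C_NormedModule a l.

Definition Csum_list (a : nat -> nat -> C) (s : list (nat * nat)) : C :=
  fold_right (fun pq acc => a (fst pq) (snd pq) + acc) (RtoC 0) s.

(** Unconditional convergence of a double series: the sums over finite subsets
    of nat * nat (duplicate-free lists), directed by inclusion, tend to [l].
    In C this amounts to absolute convergence with sum [l]. *)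
Definition is_Cdouble_series (a : nat -> nat -> C) (l : C) : Prop :=
  forall eps : R, (0 < eps)%R ->
    exists s0 : list (nat * nat),
      forall s : list (nat * nat), NoDup s -> incl s0 s ->
        (Cmod (Csum_list a s - l) < eps)%R.

(* Main.v *)
(** The polynomials [h_{p,q}(x, y)] with [h_{0,q} = y^q] and
    [h_{p+1,q} = x h_{p,q} - q h_{p,q-1}] satisfy
    [d/dx h_{p,q} = p h_{p-1,q}] and [d/dy h_{p,q} = q h_{p,q-1}], so each
    Wirtinger derivative of [h_{p,q}(z, conj z) e^{-z conj z}] raises one index
    and flips the sign; hence [H_{p,q}(z) = h_{p,q}(z, conj z)].  The symmetric
    recursion [h_{p,q+1} = y h_{p,q} - p h_{p-1,q}] says that passing from [q]
    to [q+1] multiplies the exponential generating function in [p] by [y - u];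
    for [q = 0] it is the series of [e^{ux}].  With absolute values the same
    recursion bounds the sums of moduli over all finite boxes, and this
    absolute summability turns the iterated sum into the unconditional one. *)

Require Import Defs.
From Stdlib Require Import Reals Factorial List Lra Lia Permutation FunctionalExtensionality Classical.
From Coquelicot Require Import Coquelicot.
Open Scope C_scope.

(** * Calculus of Wirtinger derivatives *)

(** Here [a] and [b] are the values of the derivatives in z and conj z; the real partials are
    recovered from them as a + b and i(a - b). Since [Derive] is total, the algebraic rules need
    existence of all four real derivatives, which this predicate carries along. *)
Definition has_wirtinger (f : C -> C) (z a b : C) : Prop :=
  is_derive (fun t : R => Re (f (t, Im z))) (Re z) (Re (a + b)) /\
  is_derive (fun t : R => Im (f (t, Im z))) (Re z) (Im (a + b)) /\
  is_derive (fun t : R => Re (f (Re z, t))) (Im z) (Re (Ci * (a - b))) /\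
  is_derive (fun t : R => Im (f (Re z, t))) (Im z) (Im (Ci * (a - b))).

Lemma has_wirtinger_partial f z a b :
  has_wirtinger f z a b -> partial_z f z = a /\ partial_zbar f z = b.
Proof.
  intros (H1 & H2 & H3 & H4).
  unfold partial_z, partial_zbar, partial_x, partial_y.
  rewrite (is_derive_unique _ _ _ H1), (is_derive_unique _ _ _ H2),
    (is_derive_unique _ _ _ H3), (is_derive_unique _ _ _ H4).
  destruct a as [a1 a2], b as [b1 b2]; split; apply injective_projections;
    simpl; field.
Qed.

Lemma is_derive_Rmult (f g : R -> R) (x f' g' : R) :
  is_derive f x f' -> is_derive g x g' ->
  is_derive (fun t => f t * g t)%R x (f' * g x + f x * g')%R.
Proof.
  intros Hf Hg; exact (is_derive_mult f g x f' g' Hf Hg Rmult_comm).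
Qed.

Lemma has_wirtinger_minus f g z a b a' b' :
  has_wirtinger f z a b -> has_wirtinger g z a' b' ->
  has_wirtinger (fun w => f w - g w) z (a - a') (b - b').
Proof.
  intros (H1 & H2 & H3 & H4) (K1 & K2 & K3 & K4).
  destruct z as [x y], a as [a1 a2], b as [b1 b2], a' as [a1' a2'], b' as [b1' b2'].
  refine (conj _ (conj _ (conj _ _))); simpl in *;
    [ evar_last; [exact (is_derive_minus _ _ _ _ _ H1 K1)|]
    | evar_last; [exact (is_derive_minus _ _ _ _ _ H2 K2)|]
    | evar_last; [exact (is_derive_minus _ _ _ _ _ H3 K3)|]
    | evar_last; [exact (is_derive_minus _ _ _ _ _ H4 K4)|] ];
    unfold minus, plus, opp; simpl; ring.
Qed.

Lemma has_wirtinger_mult f g z a b a' b' :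
  has_wirtinger f z a b -> has_wirtinger g z a' b' ->
  has_wirtinger (fun w => f w * g w) z (a * g z + f z * a') (b * g z + f z * b').
Proof.
  intros (H1 & H2 & H3 & H4) (K1 & K2 & K3 & K4).
  destruct z as [x y], a as [a1 a2], b as [b1 b2], a' as [a1' a2'], b' as [b1' b2'].
  refine (conj _ (conj _ (conj _ _))); simpl in *;
    [ evar_last; [exact (is_derive_minus _ _ _ _ _ (is_derive_Rmult _ _ _ _ _ H1 K1)
                          (is_derive_Rmult _ _ _ _ _ H2 K2))|]
    | evar_last; [exact (is_derive_plus _ _ _ _ _ (is_derive_Rmult _ _ _ _ _ H1 K2)
                          (is_derive_Rmult _ _ _ _ _ H2 K1))|]
    | evar_last; [exact (is_derive_minus _ _ _ _ _ (is_derive_Rmult _ _ _ _ _ H3 K3)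
                          (is_derive_Rmult _ _ _ _ _ H4 K4))|]
    | evar_last; [exact (is_derive_plus _ _ _ _ _ (is_derive_Rmult _ _ _ _ _ H3 K4)
                          (is_derive_Rmult _ _ _ _ _ H4 K3))|] ];
    unfold minus, plus, opp; simpl; unfold Re, Im; ring.
Qed.

Lemma has_wirtinger_const c z : has_wirtinger (fun _ => c) z 0 0.
Proof.
  refine (conj _ (conj _ (conj _ _))); simpl; auto_derive; trivial; ring.
Qed.

Lemma has_wirtinger_id z : has_wirtinger (fun w => w) z 1 0.
Proof.
  refine (conj _ (conj _ (conj _ _))); simpl; auto_derive; trivial; ring.
Qed.

Lemma has_wirtinger_conj z : has_wirtinger Cconj z 0 1.
Proof.
  refine (conj _ (conj _ (conj _ _))); simpl; auto_derive; trivial; ring.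
Qed.

(** * The polynomials h_{p,q} and the closed form of [Hermite] *)

Definition gauss (w : C) : C := Cexp (- (w * Cconj w)).

Lemma has_wirtinger_gauss z :
  has_wirtinger gauss z (- Cconj z * gauss z) (- z * gauss z).
Proof.
  destruct z as [x y]; refine (conj _ (conj _ (conj _ _))); simpl; auto_derive; trivial;
    unfold Rminus; simpl; ring.
Qed.

(* Bivariate form of the polynomial: [Hermite p q z = hpol p q z (Cconj z)]. *)
Fixpoint hpol (p q : nat) (x y : C) : C :=
  match p with
  | O => y ^ q
  | S p' => x * hpol p' q x y - INR q * hpol p' (pred q) x y
  end.

Lemma hpol_succ_r p q x y :
  hpol p (S q) x y = y * hpol p q x y - INR p * hpol (pred p) q x y.
Proof.
  revert q; induction p as [|p IH]; intros q.
  - simpl; ring.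
  (* The recursions at [pred q] and [pred p] break down at index 0, where [pred 0 = 0]. Multiplied
     by [INR q] and [INR p] they hold for every index. *)
  - assert (Hq : INR q * (y * hpol p (pred q) x y)
        = INR q * (hpol p q x y + INR p * hpol (pred p) (pred q) x y)).
    { destruct q as [|q]; [change (INR 0) with 0%R; ring|].
      rewrite (IH q); simpl pred; ring. }
    assert (Hp : INR p * hpol p q x y
        = INR p * (x * hpol (pred p) q x y - INR q * hpol (pred p) (pred q) x y)).
    { destruct p as [|p]; [change (INR 0) with 0%R; ring|reflexivity]. }
    change (hpol (S p) (S q) x y)
      with (x * hpol p (S q) x y - INR (S q) * hpol p q x y).
    change (hpol (S p) q x y)
      with (x * hpol p q x y - INR q * hpol p (pred q) x y).
    rewrite IH, !S_INR, !RtoC_plus; simpl pred.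
    (* The last bracket is zero by [Hq]; adding it lets [ring] match the left side, and [Hp] then
       matches the right side. *)
    transitivity (y * (x * hpol p q x y) - INR q * (y * hpol p (pred q) x y)
      - hpol p q x y
      - INR p * (x * hpol (pred p) q x y - INR q * hpol (pred p) (pred q) x y)
      + (INR q * (y * hpol p (pred q) x y)
         - INR q * (hpol p q x y + INR p * hpol (pred p) (pred q) x y))).
    + ring.
    + rewrite <- Hp; rewrite Hq at 2; ring.
Qed.

Lemma has_wirtinger_eq f z a b a' b' :
  has_wirtinger f z a b -> a = a' -> b = b' -> has_wirtinger f z a' b'.
Proof.
  intros H -> ->; exact H.
Qed.

(** The identity has derivatives (1, 0) and conjugation (0, 1), so w and conj w behave as
    independent variables. Differentiating the defining recursion by the product rule carries both
    formulas from p to p + 1; the case p = 0 is the power rule, by induction on q. *)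
Lemma has_wirtinger_hpol p q z :
  has_wirtinger (fun w => hpol p q w (Cconj w)) z
    (INR p * hpol (pred p) q z (Cconj z)) (INR q * hpol p (pred q) z (Cconj z)).
Proof.
  revert q; induction p as [|p IH]; intros q.
  - induction q as [|q IHq].
    + eapply has_wirtinger_eq; [exact (has_wirtinger_const 1 z)| |]; simpl; ring.
    + eapply has_wirtinger_eq;
        [exact (has_wirtinger_mult _ _ _ _ _ _ _ (has_wirtinger_conj z) IHq)| |].
      * simpl; ring.
      * rewrite S_INR, RtoC_plus; simpl pred.
        destruct q as [|q]; simpl hpol; simpl pred; [simpl; ring|]. ring.
  - eapply has_wirtinger_eq;
      [exact (has_wirtinger_minus _ _ _ _ _ _ _
        (has_wirtinger_mult _ _ _ _ _ _ _ (has_wirtinger_id z) (IH q))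
        (has_wirtinger_mult _ _ _ _ _ _ _
           (has_wirtinger_const (INR q) z) (IH (pred q))))| |].
    + rewrite S_INR, RtoC_plus; simpl pred.
      destruct p as [|p]; [change (INR 0) with 0%R; ring|].
      change (hpol (S p) q z (Cconj z))
        with (z * hpol p q z (Cconj z) - INR q * hpol p (pred q) z (Cconj z)).
      simpl pred; ring.
    + change (hpol (S p) (pred q) z (Cconj z))
        with (z * hpol p (pred q) z (Cconj z)
          - INR (pred q) * hpol p (pred (pred q)) z (Cconj z)).
      cbv beta; ring.
Qed.

(** [hpol 0 q] depends on conj w alone, so each [partial_z] acts only on the Gaussian and brings
    down a factor -conj w. *)
Lemma iter_partial_z_gauss q :
  Nat.iter q partial_z gauss
  = fun w => RtoC (-1) ^ q * hpol 0 q w (Cconj w) * gauss w.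
Proof.
  induction q as [|q IH]; simpl Nat.iter.
  - apply functional_extensionality; intros w; simpl; ring.
  - rewrite IH; apply functional_extensionality; intros w.
    refine (eq_trans (proj1 (has_wirtinger_partial _ _ _ _
      (has_wirtinger_mult _ _ _ _ _ _ _
        (has_wirtinger_mult _ _ _ _ _ _ _
          (has_wirtinger_const (RtoC (-1) ^ q) w) (has_wirtinger_hpol 0 q w))
        (has_wirtinger_gauss w)))) _).
    change (RtoC (INR 0)) with (RtoC 0); rewrite Cpow_S; simpl; ring.
Qed.

(** With G the Gaussian, the derivative of h_{p,q} G in conj w is (q h_{p,q-1} - w h_{p,q}) G, which
    is -h_{p+1,q} G by the definition of [hpol]. *)
Lemma iter_partial_zbar_gauss p q :
  Nat.iter p partial_zbar (Nat.iter q partial_z gauss)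
  = fun w => RtoC (-1) ^ (p + q) * hpol p q w (Cconj w) * gauss w.
Proof.
  induction p as [|p IH]; simpl Nat.iter.
  - apply iter_partial_z_gauss.
  - rewrite IH; apply functional_extensionality; intros w.
    refine (eq_trans (proj2 (has_wirtinger_partial _ _ _ _
      (has_wirtinger_mult _ _ _ _ _ _ _
        (has_wirtinger_mult _ _ _ _ _ _ _
          (has_wirtinger_const (RtoC (-1) ^ (p + q)) w) (has_wirtinger_hpol p q w))
        (has_wirtinger_gauss w)))) _).
    rewrite Nat.add_succ_l, Cpow_S; simpl hpol; ring.
Qed.

Lemma Cexp_plus a b : Cexp (a + b) = Cexp a * Cexp b.
Proof.
  destruct a as [a1 a2], b as [b1 b2]; unfold Cexp; simpl.
  rewrite exp_plus, cos_plus, sin_plus.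
  apply injective_projections; simpl; ring.
Qed.

Lemma Cexp_0 : Cexp 0 = 1.
Proof.
  unfold Cexp; simpl; rewrite exp_0, cos_0, sin_0.
  apply injective_projections; simpl; ring.
Qed.

Lemma Hermite_hpol p q z : Hermite p q z = hpol p q z (Cconj z).
Proof.
  unfold Hermite; fold gauss; rewrite iter_partial_zbar_gauss.
  transitivity (((RtoC (-1) * RtoC (-1)) ^ (p + q)) * (Cexp (z * Cconj z) * gauss z)
    * hpol p q z (Cconj z)).
  { rewrite Cpow_mult_l; ring. }
  unfold gauss; rewrite <- Cexp_plus, Cplus_opp_r, Cexp_0, <- RtoC_mult.
  replace (-1 * -1)%R with 1%R by ring.
  rewrite Cpow_1_l; ring.
Qed.

(** * The power series of [Cexp], by estimating the Taylor remainder *)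

(** Both g + f and g - f vanish at 0 and have nonnegative derivative, so the mean value theorem
    makes them nonnegative. *)
Lemma Rabs_le_of_derive_le (f g f' g' : R -> R) :
  (forall t, 0 <= t <= 1 -> is_derive f t (f' t))%R ->
  (forall t, 0 <= t <= 1 -> is_derive g t (g' t))%R ->
  (forall t, 0 <= t <= 1 -> Rabs (f' t) <= g' t)%R ->
  f 0%R = 0%R -> g 0%R = 0%R ->
  (forall t, 0 <= t <= 1 -> Rabs (f t) <= g t)%R.
Proof.
  intros Hf Hg Hle f0 g0 t Ht.
  assert (Hmono : forall h h' : R -> R,
    (forall s, 0 <= s <= 1 -> is_derive h s (h' s))%R ->
    (forall s, 0 <= s <= 1 -> 0 <= h' s)%R -> h 0%R = 0%R -> (0 <= h t)%R).
  { intros h h' Hh Hpos h0.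
    destruct (MVT_gen h 0 t h') as (c & Hc & Heq).
    - rewrite Rmin_left, Rmax_right by lra; intros s Hs; apply Hh; lra.
    - rewrite Rmin_left, Rmax_right by lra; intros s Hs.
      apply continuity_pt_filterlim, (ex_derive_continuous h); exists (h' s); apply Hh; lra.
    - rewrite Rmin_left, Rmax_right in Hc by lra.
      rewrite h0, !Rminus_0_r in Heq; rewrite Heq.
      apply Rmult_le_pos; [apply Hpos|]; lra. }
  apply Rabs_le; split.
  - assert (H := Hmono (fun s => plus (g s) (f s)) (fun s => plus (g' s) (f' s))).
    unfold plus in H; simpl in H.
    enough (0 <= g t + f t)%R by lra.
    apply H; [intros s Hs; apply (is_derive_plus g f); auto| |rewrite f0, g0; ring].
    intros s Hs; specialize (Hle s Hs); apply Rabs_le_between in Hle; lra.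
  - assert (H := Hmono (fun s => minus (g s) (f s)) (fun s => minus (g' s) (f' s))).
    unfold minus, plus, opp in H; simpl in H.
    enough (0 <= g t + - f t)%R by lra.
    apply H; [intros s Hs; apply (is_derive_minus g f); auto| |rewrite f0, g0; ring].
    intros s Hs; specialize (Hle s Hs); apply Rabs_le_between in Hle; lra.
Qed.

(** The remainder of e^{tz} after the Taylor terms of index below n. The real parameter t reduces
    the estimate to one-variable calculus on [0, 1]. *)
Fixpoint exp_remainder (z : C) (n : nat) (t : R) : C :=
  match n with
  | O => Cexp (t * z)
  | S n' => exp_remainder z n' t - RtoC (t ^ n' / INR (fact n')) * z ^ n'
  end.

Lemma is_derive_pow_fact (n : nat) (t : R) :
  is_derive (fun s : R => s ^ S n / INR (fact (S n)))%R t (t ^ n / INR (fact n))%R.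
Proof.
  auto_derive; [trivial|].
  change (pred (S n)) with n.
  change (fact n + n * fact n)%nat with (S n * fact n)%nat; rewrite mult_INR.
  change (match n with O => 1%R | S _ => (INR n + 1)%R end) with (INR (S n)).
  field; split; [apply INR_fact_neq_0|apply not_0_INR; discriminate].
Qed.

(** Differentiation in t kills the term of index 0 and turns the term of index k + 1 into z times
    the term of index k, so the order of the remainder drops by one. *)
Lemma is_derive_exp_remainder z n t :
  is_derive (fun s => Re (exp_remainder z (S n) s)) t (Re (z * exp_remainder z n t)) /\
  is_derive (fun s => Im (exp_remainder z (S n) s)) t (Im (z * exp_remainder z n t)).
Proof.
  induction n as [|n [IHr IHi]].
  - destruct z as [x y]; split; simpl; auto_derive; trivial; unfold Rminus; ring.
  - split.
    + apply (is_derive_ext (fun s => minus (Re (exp_remainder z (S n) s))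
        (s ^ S n / INR (fact (S n)) * Re (z ^ S n)))%R).
      { intros s; change (exp_remainder z (S (S n)) s) with
          (exp_remainder z (S n) s - RtoC (s ^ S n / INR (fact (S n))) * z ^ S n).
        rewrite <- re_scal_l; reflexivity. }
      evar_last.
      { exact (is_derive_minus _ _ _ _ _ IHr
          (is_derive_Rmult _ _ _ _ _ (is_derive_pow_fact n t)
            (is_derive_const (Re (z ^ S n)) t))). }
      simpl exp_remainder; rewrite Cpow_S; destruct z as [x y].
      unfold minus, plus, opp, zero; simpl; unfold Re, Im; simpl; ring.
    + apply (is_derive_ext (fun s => minus (Im (exp_remainder z (S n) s))
        (s ^ S n / INR (fact (S n)) * Im (z ^ S n)))%R).
      { intros s; change (exp_remainder z (S (S n)) s) with
          (exp_remainder z (S n) s - RtoC (s ^ S n / INR (fact (S n))) * z ^ S n).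
        rewrite <- im_scal_l; reflexivity. }
      evar_last.
      { exact (is_derive_minus _ _ _ _ _ IHi
          (is_derive_Rmult _ _ _ _ _ (is_derive_pow_fact n t)
            (is_derive_const (Im (z ^ S n)) t))). }
      simpl exp_remainder; rewrite Cpow_S; destruct z as [x y].
      unfold minus, plus, opp, zero; simpl; unfold Re, Im; simpl; ring.
Qed.

Lemma exp_remainder_0 z n : exp_remainder z (S n) 0 = 0.
Proof.
  induction n as [|n IH].
  - simpl; rewrite Cmult_0_l, Cexp_0.
    apply injective_projections; simpl; field.
  - change (exp_remainder z (S (S n)) 0) with
      (exp_remainder z (S n) 0 - RtoC (0 ^ S n / INR (fact (S n))) * z ^ S n).
    rewrite IH, pow_i by lia; unfold Rdiv; rewrite Rmult_0_l; ring.
Qed.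

Lemma Cmod_le_Re_Im c : (Cmod c <= Rabs (Re c) + Rabs (Im c))%R.
Proof.
  destruct c as [x y].
  replace ((x, y) : C) with (RtoC x + Ci * RtoC y)
    by (apply injective_projections; simpl; ring).
  eapply Rle_trans; [apply Cmod_triangle|].
  rewrite Cmod_mult, Cmod_Ci, !Cmod_R, Rmult_1_l; simpl.
  right; f_equal; f_equal; ring.
Qed.

Lemma Cmod_Cexp c : Cmod (Cexp c) = exp (Re c).
Proof.
  replace (Cexp c) with (RtoC (exp (Re c)) * (cos (Im c), sin (Im c)))
    by (apply injective_projections; simpl; ring).
  rewrite Cmod_mult, Cmod_R, Rabs_pos_eq by (left; apply exp_pos).
  unfold Cmod; simpl fst; simpl snd.
  replace (cos (Im c) ^ 2 + sin (Im c) ^ 2)%R with 1%R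
    by (rewrite <- (sin2_cos2 (Im c)); unfold Rsqr; ring).
  rewrite sqrt_1; ring.
Qed.

(* The mean value argument works on real and imaginary parts separately, which
   costs a factor 2 per step through [Cmod c <= |Re c| + |Im c|]. *)
Lemma exp_remainder_bound z n t : (0 <= t <= 1)%R ->
  (Rabs (Re (exp_remainder z n t))
     <= exp (Cmod z) * (2 * Cmod z) ^ n * (t ^ n / INR (fact n)) /\
   Rabs (Im (exp_remainder z n t))
     <= exp (Cmod z) * (2 * Cmod z) ^ n * (t ^ n / INR (fact n)))%R.
Proof.
  assert (Hz := Cmod_ge_0 z).
  revert t; induction n as [|n IH]; intros t Ht.
  - replace (exp (Cmod z) * (2 * Cmod z) ^ 0 * (t ^ 0 / INR (fact 0)))%R
      with (exp (Cmod z)) by (simpl; field).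
    assert (H : (Cmod (exp_remainder z 0 t) <= exp (Cmod z))%R).
    { simpl; rewrite Cmod_Cexp, re_scal_l.
      assert (Re z <= Cmod z)%R by (eapply Rle_trans; [apply Rle_abs|apply re_le_Cmod]).
      destruct (Rle_lt_or_eq (t * Re z) (Cmod z)) as [Hlt|Heq]; [nra| |].
      - left; apply exp_increasing, Hlt.
      - rewrite Heq; right; reflexivity. }
    split; (eapply Rle_trans; [|exact H]).
    + apply re_le_Cmod.
    + eapply Rle_trans; [apply Rmax_r|apply Rmax_Cmod].
  - assert (Hstep : forall s, (0 <= s <= 1)%R ->
      (Cmod (z * exp_remainder z n s)
       <= exp (Cmod z) * (2 * Cmod z) ^ S n * (s ^ n / INR (fact n)))%R).
    { intros s Hs; destruct (IH s Hs) as [H1 H2].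
      rewrite Cmod_mult.
      assert (H3 := Cmod_le_Re_Im (exp_remainder z n s)).
      simpl pow; nra. }
    (* The majorant for n + 1 is the antiderivative, vanishing at 0, of the bound in [Hstep]. *)
    assert (Hg : forall s, (0 <= s <= 1)%R ->
      is_derive (fun s => exp (Cmod z) * (2 * Cmod z) ^ S n * (s ^ S n / INR (fact (S n))))%R s
        (exp (Cmod z) * (2 * Cmod z) ^ S n * (s ^ n / INR (fact n)))%R).
    { intros s _; apply (is_derive_scal (fun s => s ^ S n / INR (fact (S n)))%R).
      apply is_derive_pow_fact. }
    split.
    + apply (Rabs_le_of_derive_le (fun s => Re (exp_remainder z (S n) s)) _
        (fun s => Re (z * exp_remainder z n s)) _
        (fun s _ => proj1 (is_derive_exp_remainder z n s)) Hg).
      * intros s Hs; eapply Rle_trans; [apply re_le_Cmod|apply Hstep, Hs].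
      * rewrite exp_remainder_0; reflexivity.
      * rewrite pow_i by lia; unfold Rdiv; ring.
      * exact Ht.
    + apply (Rabs_le_of_derive_le (fun s => Im (exp_remainder z (S n) s)) _
        (fun s => Im (z * exp_remainder z n s)) _
        (fun s _ => proj2 (is_derive_exp_remainder z n s)) Hg).
      * intros s Hs; eapply Rle_trans; [|apply Hstep, Hs].
        eapply Rle_trans; [apply Rmax_r|apply Rmax_Cmod].
      * rewrite exp_remainder_0; reflexivity.
      * rewrite pow_i by lia; unfold Rdiv; ring.
      * exact Ht.
Qed.

Lemma is_Cseries_eps (a : nat -> C) (l : C) :
  is_Cseries a l <->
  forall eps : R, (0 < eps)%R ->
    exists N, forall n, (N <= n)%nat -> (Cmod (@sum_n C_AbelianMonoid a n - l) < eps)%R.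
Proof.
  unfold is_Cseries, is_series.
  rewrite (filterlim_locally_ball_norm (K := C_AbsRing) (U := C_NormedModule)).
  split.
  - intros H eps Heps; exact (H (mkposreal eps Heps)).
  - intros H [eps Heps]; exact (H eps Heps).
Qed.

Lemma sum_n_exp_remainder z n :
  Cexp z - exp_remainder z (S n) 1
  = @sum_n C_AbelianMonoid (fun k => z ^ k / RtoC (INR (fact k))) n.
Proof.
  assert (H : forall k, RtoC (1 ^ k / INR (fact k)) * z ^ k = z ^ k / RtoC (INR (fact k))).
  { intros k; rewrite pow1; unfold Rdiv; rewrite Rmult_1_l, RtoC_inv by apply INR_fact_neq_0.
    apply Cmult_comm. }
  induction n as [|n IH].
  - rewrite sum_O, <- H; simpl; rewrite Cmult_1_l; ring.
  - rewrite sum_Sn, <- IH, <- H.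
    change (exp_remainder z (S (S n)) 1) with
      (exp_remainder z (S n) 1 - RtoC (1 ^ S n / INR (fact (S n))) * z ^ S n).
    change (@plus C_AbelianMonoid) with Cplus; ring.
Qed.

Lemma is_Cseries_exp z :
  is_Cseries (fun k => z ^ k / RtoC (INR (fact k))) (Cexp z).
Proof.
  apply is_Cseries_eps; intros eps Heps.
  assert (Hpos := exp_pos (Cmod z)).
  (* The real and imaginary parts of the remainder each contribute at most e^{|z|} (2|z|)^{n+1} /
     (n+1)!, whence the divisor 2 e^{|z|}. *)
  destruct (cv_speed_pow_fact (2 * Cmod z) (eps / (2 * exp (Cmod z)))%R) as [N HN].
  { apply Rdiv_lt_0_compat; lra. }
  exists N; intros n Hn.
  rewrite <- sum_n_exp_remainder.
  replace (Cexp z - exp_remainder z (S n) 1 - Cexp z)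
    with (- exp_remainder z (S n) 1) by ring.
  rewrite Cmod_opp; eapply Rle_lt_trans; [apply Cmod_le_Re_Im|].
  destruct (exp_remainder_bound z (S n) 1) as [H1 H2]; [lra|].
  specialize (HN (S n) ltac:(lia)); unfold Rdist in HN; rewrite Rminus_0_r in HN.
  rewrite pow1 in H1, H2.
  apply Rabs_def2 in HN; destruct HN as [HN _].
  apply (Rmult_lt_compat_l (2 * exp (Cmod z))) in HN; [|lra].
  replace (2 * exp (Cmod z) * (eps / (2 * exp (Cmod z))))%R with eps in HN by (field; lra).
  unfold Rdiv in *; lra.
Qed.

(** * Exponential generating functions in one index *)

Lemma RtoC_fact_neq_0 p : RtoC (INR (fact p)) <> 0.
Proof.
  intros H; apply (INR_fact_neq_0 p), RtoC_inj, H.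
Qed.

Lemma pow_fact_succ (u : C) p :
  u ^ S p / RtoC (INR (fact (S p))) * INR (S p) = u * (u ^ p / RtoC (INR (fact p))).
Proof.
  rewrite fact_simpl, mult_INR, RtoC_mult, Cpow_S; field; split;
    [apply RtoC_fact_neq_0|].
  intros H; apply RtoC_inj in H; revert H; apply not_0_INR; discriminate.
Qed.

(** Because p u^p / p! = u u^{p-1} / (p-1)!, the sequence p a_{p-1} has generating function u l;
    subtracting it from y l gives the factor y - u. *)
Lemma is_Cseries_gen_step (a b : nat -> C) (u y l : C) :
  (forall p, b p = y * a p - INR p * a (pred p)) ->
  is_Cseries (fun p => u ^ p / RtoC (INR (fact p)) * a p) l ->
  is_Cseries (fun p => u ^ p / RtoC (INR (fact p)) * b p) ((y - u) * l).
Proof.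
  intros Hb Ha; unfold is_Cseries in *.
  pose proof (fun c : C => @is_series_scal C_AbsRing C_NormedModule c _ _ Ha) as Hscal.
  assert (Hs : @is_series C_AbsRing C_NormedModule
    (fun p => u ^ p / RtoC (INR (fact p)) * (INR p * a (pred p))) (u * l)).
  (* The term at p = 0 vanishes through its factor [INR 0], so dropping it shifts the index without
     changing the sum. *)
  { apply is_series_decr_1.
    refine (eq_ind (u * l) (fun m : C_NormedModule => is_series _ m) _ _ _).
    - refine (is_series_ext _ _ _ _ (Hscal u)); intros p.
      change (u * (u ^ p / RtoC (INR (fact p)) * a p)
        = u ^ S p / RtoC (INR (fact (S p))) * (INR (S p) * a p)).
      rewrite !Cmult_assoc, pow_fact_succ; reflexivity.
    - change (u * l = u * l + - (u ^ 0 / RtoC (INR (fact 0)) * (0 * a 0%nat))); ring. }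
  replace ((y - u) * l) with (y * l + - (u * l)) by ring.
  refine (is_series_ext _ _ _ _
    (@is_series_minus C_AbsRing C_NormedModule _ _ _ _ (Hscal y) Hs)); intros p.
  rewrite Hb.
  change (y * (u ^ p / RtoC (INR (fact p)) * a p)
    + - (u ^ p / RtoC (INR (fact p)) * (INR p * a (pred p)))
    = u ^ p / RtoC (INR (fact p)) * (y * a p - INR p * a (pred p))); ring.
Qed.

Lemma is_Cseries_exp_scaled (u x : C) (a : nat -> C) :
  (forall p, a p = x ^ p) ->
  is_Cseries (fun p => u ^ p / RtoC (INR (fact p)) * a p) (Cexp (u * x)).
Proof.
  intros Ha; eapply is_series_ext; [|exact (is_Cseries_exp (u * x))].
  intros p; simpl; rewrite Ha, Cpow_mult_l; unfold Cdiv.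
  rewrite <- !Cmult_assoc; f_equal; apply Cmult_comm.
Qed.

Lemma hpol_0_r p x y : hpol p 0 x y = x ^ p.
Proof.
  induction p as [|p IH]; [reflexivity|].
  change (hpol (S p) 0 x y) with (x * hpol p 0 x y - 0 * hpol p 0 x y).
  rewrite IH, Cpow_S; ring.
Qed.

Lemma is_Cseries_hpol_l u x y q :
  is_Cseries (fun p => u ^ p / RtoC (INR (fact p)) * hpol p q x y)
    ((y - u) ^ q * Cexp (u * x)).
Proof.
  induction q as [|q IH].
  - rewrite Cmult_1_l; apply is_Cseries_exp_scaled.
    intros p; apply hpol_0_r.
  - rewrite Cpow_S, <- Cmult_assoc.
    apply (is_Cseries_gen_step (fun p => hpol p q x y)); [|exact IH].
    intros p; apply hpol_succ_r.
Qed.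

(** For fixed p the recursion that defines [hpol] already has the shape required by
    [is_Cseries_gen_step], with q as the summation index; hence the closing [reflexivity]. *)
Lemma is_Cseries_hpol_r v x y p :
  is_Cseries (fun q => v ^ q / RtoC (INR (fact q)) * hpol p q x y)
    ((x - v) ^ p * Cexp (v * y)).
Proof.
  induction p as [|p IH].
  - rewrite Cmult_1_l; apply is_Cseries_exp_scaled; reflexivity.
  - rewrite Cpow_S, <- Cmult_assoc.
    apply (is_Cseries_gen_step (fun q => hpol p q x y)); [|exact IH]; reflexivity.
Qed.

(** * Uniform bound on the sums of moduli *)

(** The generating function step with absolute values: |h_{p,q+1}| <= |y| |h_{p,q}| + p |h_{p-1,q}|,
    so each increase of q costs a factor |y| + |u|. For q = 0 the sum is a partial sum of the series
    of e^{|u||x|}. *)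
Lemma sum_abs_hpol_le (u x y : C) (q P : nat) :
  (sum_f_R0 (fun p => Cmod u ^ p / INR (fact p) * Cmod (hpol p q x y)) P
   <= (Cmod y + Cmod u) ^ q * exp (Cmod u * Cmod x))%R.
Proof.
  assert (Hu := Cmod_ge_0 u); assert (Hx := Cmod_ge_0 x); assert (Hy := Cmod_ge_0 y).
  assert (Hc : forall p, (0 <= Cmod u ^ p / INR (fact p))%R).
  { intros p; apply Rdiv_le_0_compat; [apply pow_le, Hu|apply INR_fact_lt_0]. }
  revert P; induction q as [|q IH]; intros P.
  - rewrite pow_O, Rmult_1_l.
    eapply Rle_trans; [|apply (exp_ge_taylor _ P), Rmult_le_pos; assumption].
    apply sum_growing; intros p; right.
    rewrite hpol_0_r, Cmod_pow, Rpow_mult_distr; field; apply INR_fact_neq_0.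
  - set (f := fun p => (Cmod u ^ p / INR (fact p) * Cmod (hpol p q x y))%R) in *.
    set (g := fun p => (Cmod u ^ p / INR (fact p) * (INR p * Cmod (hpol (pred p) q x y)))%R).
    (* Shifting the index turns the sum of [g] up to P into |u| times the sum of [f] up to P - 1,
       which the induction hypothesis covers because it holds for every length. *)
    assert (Hg : (sum_f_R0 g P <= Cmod u * ((Cmod y + Cmod u) ^ q * exp (Cmod u * Cmod x)))%R).
    { assert (Hg0 : g 0%nat = 0%R) by (unfold g; simpl; ring).
      destruct P as [|P].
      - simpl; rewrite Hg0; apply Rmult_le_pos, Rmult_le_pos; [assumption| |left; apply exp_pos].
        apply pow_le; lra.
      - rewrite decomp_sum by lia; rewrite Hg0, Rplus_0_l; simpl pred.
        rewrite (sum_eq _ (fun p => f p * Cmod u)%R).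
        + rewrite <- scal_sum; apply Rmult_le_compat_l; [assumption|apply IH].
        + intros p _; unfold f, g; simpl pred.
          rewrite fact_simpl, mult_INR; simpl pow; field.
          split; [apply INR_fact_neq_0|apply not_0_INR; discriminate]. }
    apply Rle_trans with (sum_f_R0 (fun p => f p * Cmod y + g p)%R P).
    + apply sum_growing; intros p; unfold f, g.
      rewrite hpol_succ_r; unfold Cminus.
      assert (H := Cmod_triangle (y * hpol p q x y) (- (INR p * hpol (pred p) q x y))).
      rewrite Cmod_opp, !Cmod_mult, Cmod_R, (Rabs_pos_eq (INR p)) in H by apply pos_INR.
      specialize (Hc p); nra.
    + rewrite sum_plus, <- scal_sum.
      specialize (IH P); simpl pow; nra.
Qed.

(** * Finite sums over sets of index pairs *)

Definition Rsum_list (a : nat -> nat -> R) (s : list (nat * nat)) : R :=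
  fold_right (fun pq acc => a (fst pq) (snd pq) + acc)%R 0%R s.

Lemma Csum_list_app a s t : Csum_list a (s ++ t) = Csum_list a s + Csum_list a t.
Proof.
  induction s as [|x s IH]; simpl; [|rewrite IH]; ring.
Qed.

Lemma Rsum_list_app a s t : Rsum_list a (s ++ t) = (Rsum_list a s + Rsum_list a t)%R.
Proof.
  induction s as [|x s IH]; simpl; [|rewrite IH]; ring.
Qed.

Lemma Csum_list_perm a s t : Permutation s t -> Csum_list a s = Csum_list a t.
Proof.
  induction 1; simpl; [reflexivity|congruence|ring|congruence].
Qed.

Lemma Rsum_list_perm a s t : Permutation s t -> Rsum_list a s = Rsum_list a t.
Proof.
  induction 1; simpl; [reflexivity|congruence|ring|congruence].
Qed.

Lemma Rsum_list_pos a s : (forall p q, 0 <= a p q)%R -> (0 <= Rsum_list a s)%R.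
Proof.
  intros Ha; induction s as [|x s IH]; simpl; [lra|].
  specialize (Ha (fst x) (snd x)); lra.
Qed.

Lemma Cmod_Csum_list_le a s :
  (Cmod (Csum_list a s) <= Rsum_list (fun p q => Cmod (a p q)) s)%R.
Proof.
  induction s as [|x s IH]; simpl; [rewrite Cmod_0; lra|].
  eapply Rle_trans; [apply Cmod_triangle|]; lra.
Qed.

(** Used to split a sum over a larger index set into the sum over [s] and the sum over the remaining
    indices. *)
Lemma NoDup_incl_permutation_app {A : Type} (s t : list A) :
  NoDup s -> incl s t -> exists r, Permutation t (s ++ r).
Proof.
  intros Hs; revert t; induction Hs as [|x s Hx Hs IH]; intros t Ht.
  - exists t; reflexivity.
  - destruct (in_split x t (Ht x (or_introl eq_refl))) as (t1 & t2 & ->).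
    destruct (IH (t1 ++ t2)) as [r Hr].
    { intros y Hy; specialize (Ht y (or_intror Hy)).
      apply in_app_iff in Ht; apply in_app_iff.
      destruct Ht as [|[->|]]; tauto. }
    exists r; simpl; rewrite <- Hr; symmetry; apply Permutation_middle.
Qed.

Definition row (P q : nat) : list (nat * nat) := map (fun p => (p, q)) (seq 0 P).

(** Built row by row so that its sum is an iterated sum. The bounds are strict, whereas [sum_n] and
    [sum_f_R0] include the last index; this is why [box (S P) (S Q)] matches sums up to P and Q. *)
Fixpoint box (P Q : nat) : list (nat * nat) :=
  match Q with
  | O => nil
  | S Q' => box P Q' ++ row P Q'
  end.

Lemma in_row P q p' q' : In (p', q') (row P q) <-> (p' < P)%nat /\ q' = q.
Proof.
  unfold row; rewrite in_map_iff; split.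
  - intros (p & [= <- <-] & Hp); apply in_seq in Hp; lia.
  - intros [Hp ->]; exists p'; split; [reflexivity|apply in_seq; lia].
Qed.

Lemma in_box P Q p q : In (p, q) (box P Q) <-> (p < P)%nat /\ (q < Q)%nat.
Proof.
  induction Q as [|Q IH]; simpl; [lia|].
  rewrite in_app_iff, IH, in_row; lia.
Qed.

Lemma NoDup_box P Q : NoDup (box P Q).
Proof.
  induction Q as [|Q IH]; simpl; [constructor|].
  apply NoDup_app; [exact IH| |].
  - apply NoDup_map_NoDup_ForallPairs; [|apply seq_NoDup].
    intros p p' _ _ [= ->]; reflexivity.
  - intros [p q] H1 H2; apply in_box in H1; apply in_row in H2; lia.
Qed.

Lemma incl_box (s : list (nat * nat)) : exists N, forall P Q,
  (N <= P)%nat -> (N <= Q)%nat -> incl s (box P Q).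
Proof.
  induction s as [|[p q] s [N HN]].
  - exists 0%nat; intros P Q _ _ x [].
  - exists (S (N + p + q)); intros P Q HP HQ x [<-|Hx].
    + apply in_box; lia.
    + apply (HN P Q); [lia..|exact Hx].
Qed.

Lemma Csum_list_row a P q :
  Csum_list a (row (S P) q) = @sum_n C_AbelianMonoid (fun p => a p q) P.
Proof.
  induction P as [|P IH].
  - rewrite sum_O; simpl; ring.
  - unfold row; rewrite seq_S, map_app, Csum_list_app; fold (row (S P) q).
    rewrite IH, sum_Sn; simpl; change (@plus C_AbelianMonoid) with Cplus; ring.
Qed.

Lemma Csum_list_box a P Q :
  Csum_list a (box (S P) (S Q))
  = @sum_n C_AbelianMonoid (fun q => @sum_n C_AbelianMonoid (fun p => a p q) P) Q.
Proof.
  induction Q as [|Q IH].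
  - rewrite sum_O, <- Csum_list_row; reflexivity.
  - rewrite sum_Sn, <- IH, <- Csum_list_row; apply Csum_list_app.
Qed.

Lemma Rsum_list_row a P q :
  Rsum_list a (row (S P) q) = sum_f_R0 (fun p => a p q) P.
Proof.
  induction P as [|P IH].
  - simpl; ring.
  - unfold row; rewrite seq_S, map_app, Rsum_list_app; fold (row (S P) q).
    rewrite IH; simpl; ring.
Qed.

Lemma Rsum_list_box a P Q :
  Rsum_list a (box (S P) (S Q)) = sum_f_R0 (fun q => sum_f_R0 (fun p => a p q) P) Q.
Proof.
  induction Q as [|Q IH].
  - simpl sum_f_R0; rewrite <- Rsum_list_row; reflexivity.
  - change (box (S P) (S (S Q))) with (box (S P) (S Q) ++ row (S P) (S Q)).
    rewrite Rsum_list_app, IH, Rsum_list_row; reflexivity.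
Qed.

(** * From iterated to unconditional summation *)

Lemma is_Cseries_sum_n (a : nat -> nat -> C) (r : nat -> C) (Q : nat) :
  (forall q, is_Cseries (fun p => a p q) (r q)) ->
  forall eps : R, (0 < eps)%R -> exists N, forall P, (N <= P)%nat ->
    (Cmod (@sum_n C_AbelianMonoid (fun q => @sum_n C_AbelianMonoid (fun p => a p q) P) Q
       - @sum_n C_AbelianMonoid r Q) < eps)%R.
Proof.
  intros Ha; induction Q as [|Q IH]; intros eps Heps.
  - destruct (proj1 (is_Cseries_eps _ _) (Ha 0%nat) eps Heps) as [N HN].
    exists N; intros P HP; rewrite !sum_O; apply HN, HP.
  - destruct (IH (eps / 2)%R) as [N1 HN1]; [lra|].
    destruct (proj1 (is_Cseries_eps _ _) (Ha (S Q)) (eps / 2)%R) as [N2 HN2]; [lra|].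
    exists (N1 + N2)%nat; intros P HP.
    specialize (HN1 P ltac:(lia)); specialize (HN2 P ltac:(lia)).
    rewrite !sum_Sn; change (@plus C_AbelianMonoid) with Cplus.
    match goal with |- (Cmod (?a + ?b - (?c + ?d)) < _)%R =>
      replace (a + b - (c + d)) with ((a - c) + (b - d)) by ring end.
    eapply Rle_lt_trans; [apply Cmod_triangle|]; lra.
Qed.

(** Take a finite set whose sum of moduli nearly attains the supremum: whatever is added to it
    changes the sum very little. Any larger set is therefore close to a large box, and boxes
    approach the iterated sum. *)
Lemma is_Cdouble_series_iterated (a : nat -> nat -> C) (r : nat -> C) (l : C) (B : R) :
  (forall P Q, sum_f_R0 (fun q => sum_f_R0 (fun p => Cmod (a p q)) P) Q <= B)%R ->
  (forall q, is_Cseries (fun p => a p q) (r q)) ->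
  is_Cseries r l ->
  is_Cdouble_series a l.
Proof.
  intros HB Ha Hr eps Heps.
  set (m := fun p q => Cmod (a p q)).
  assert (Hm : forall s, (0 <= Rsum_list m s)%R)
    by (intros s; apply Rsum_list_pos; intros; apply Cmod_ge_0).
  assert (Hbound : forall s, NoDup s -> (Rsum_list m s <= B)%R).
  { intros s Hs; destruct (incl_box s) as [N HN].
    destruct (NoDup_incl_permutation_app _ _ Hs (HN (S N) (S N) ltac:(lia) ltac:(lia)))
      as [t Ht].
    specialize (HB N N); rewrite <- (Rsum_list_box m) in HB.
    rewrite (Rsum_list_perm _ _ _ Ht), Rsum_list_app in HB.
    specialize (Hm t); lra. }
  destruct (completeness (fun x => exists s, NoDup s /\ x = Rsum_list m s)) as [T [HT1 HT2]].
  { exists B; intros x (s & Hs & ->); apply Hbound, Hs. }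
  { exists 0%R, nil; split; [constructor|reflexivity]. }
  (* Otherwise T - eps/4 would be an upper bound smaller than the least one. *)
  assert (Hs0 : exists s0, NoDup s0 /\ (T - eps / 4 < Rsum_list m s0)%R).
  { apply NNPP; intros Hn.
    enough (T <= T - eps / 4)%R by lra.
    apply HT2; intros x (s & Hs & ->); apply Rnot_lt_le; intros Hlt.
    apply Hn; exists s; split; assumption. }
  destruct Hs0 as (s0 & Hs0 & Hlt).
  assert (Hclose : forall s, NoDup s -> incl s0 s ->
    (Cmod (Csum_list a s - Csum_list a s0) < eps / 4)%R).
  { intros s Hs Hincl.
    destruct (NoDup_incl_permutation_app _ _ Hs0 Hincl) as [t Ht].
    assert (HsT : (Rsum_list m s <= T)%R) by (apply HT1; exists s; split; trivial).
    rewrite (Csum_list_perm _ _ _ Ht), Csum_list_app.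
    rewrite (Rsum_list_perm _ _ _ Ht), Rsum_list_app in HsT.
    replace (Csum_list a s0 + Csum_list a t - Csum_list a s0)
      with (Csum_list a t) by ring.
    assert (H := Cmod_Csum_list_le a t); fold m in H; lra. }
  exists s0; intros s Hs Hincl.
  destruct (incl_box s0) as [N HN].
  (* The number of rows is fixed first, then the row length, which depends on it. Adding N to both
     makes the box contain [s0]. *)
  destruct (proj1 (is_Cseries_eps _ _) Hr (eps / 4)%R) as [Q HQ]; [lra|].
  destruct (is_Cseries_sum_n a r (N + Q) Ha (eps / 4)%R) as [P HP]; [lra|].
  specialize (HQ (N + Q)%nat ltac:(lia)); specialize (HP (N + P)%nat ltac:(lia)).
  rewrite <- Csum_list_box in HP.
  set (b := box (S (N + P)) (S (N + Q))) in *.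
  assert (H1 := Hclose s Hs Hincl).
  assert (H2 := Hclose b (NoDup_box _ _) (HN (S (N + P)) (S (N + Q)) ltac:(lia) ltac:(lia))).
  set (R0 := @sum_n C_AbelianMonoid r (N + Q)) in *.
  (* The path from [s] to [l] runs through [s0], the box and the sum of its full rows; each of the
     four steps costs less than eps/4. *)
  replace (Csum_list a s - l) with ((Csum_list a s - Csum_list a s0)
    + (- (Csum_list a b - Csum_list a s0) + ((Csum_list a b - R0) + (R0 - l)))) by ring.
  assert (T1 := Cmod_triangle (Csum_list a s - Csum_list a s0)
    (- (Csum_list a b - Csum_list a s0) + ((Csum_list a b - R0) + (R0 - l)))).
  assert (T2 := Cmod_triangle (- (Csum_list a b - Csum_list a s0))
    ((Csum_list a b - R0) + (R0 - l))).
  assert (T3 := Cmod_triangle (Csum_list a b - R0) (R0 - l)).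
  rewrite Cmod_opp in T2; lra.
Qed.

Lemma Cmod_pow_fact (u : C) p :
  Cmod (u ^ p / RtoC (INR (fact p))) = (Cmod u ^ p / INR (fact p))%R.
Proof.
  rewrite Cmod_div by apply RtoC_fact_neq_0.
  rewrite Cmod_pow, Cmod_R, Rabs_pos_eq by apply pos_INR; reflexivity.
Qed.

Lemma is_Cseries_scal (c : C) (a : nat -> C) (l : C) :
  is_Cseries a l -> is_Cseries (fun n => c * a n) (c * l).
Proof.
  intros Ha; exact (@is_series_scal C_AbsRing C_NormedModule c a l Ha).
Qed.

Lemma is_Cseries_ext (a b : nat -> C) (l : C) :
  (forall n, a n = b n) -> is_Cseries a l -> is_Cseries b l.
Proof.
  apply is_series_ext.
Qed.

(** Summing over p first leaves v^q / q! (y - u)^q e^{ux}, whose sum over q is e^{ux} e^{v(y-u)}.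
    The same order of summation, applied to the moduli, gives the bound e^{|u||x|} e^{|v|(|y|+|u|)}
    on all boxes. *)
Lemma is_Cdouble_series_hpol (u v x y : C) :
  is_Cdouble_series
    (fun p q => u ^ p / RtoC (INR (fact p)) * (v ^ q / RtoC (INR (fact q))) * hpol p q x y)
    (Cexp (u * x + v * y - u * v)).
Proof.
  assert (Hu := Cmod_ge_0 u); assert (Hv := Cmod_ge_0 v); assert (Hy := Cmod_ge_0 y).
  apply (is_Cdouble_series_iterated _
    (fun q => v ^ q / RtoC (INR (fact q)) * ((y - u) ^ q * Cexp (u * x)))
    _ (exp (Cmod u * Cmod x) * exp (Cmod v * (Cmod y + Cmod u)))%R).
  - intros P Q.
    apply Rle_trans with (sum_f_R0 (fun q =>
      (Cmod v * (Cmod y + Cmod u)) ^ q / INR (fact q) * exp (Cmod u * Cmod x))%R Q).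
    + apply sum_growing; intros q.
      rewrite (sum_eq _ (fun p => Cmod u ^ p / INR (fact p) * Cmod (hpol p q x y)
        * (Cmod v ^ q / INR (fact q)))%R).
      2:{ intros p _; rewrite !Cmod_mult, !Cmod_pow_fact; ring. }
      rewrite <- scal_sum.
      replace ((Cmod v * (Cmod y + Cmod u)) ^ q / INR (fact q) * exp (Cmod u * Cmod x))%R
        with (Cmod v ^ q / INR (fact q) * ((Cmod y + Cmod u) ^ q * exp (Cmod u * Cmod x)))%R
        by (rewrite Rpow_mult_distr; field; apply INR_fact_neq_0).
      apply Rmult_le_compat_l; [|apply sum_abs_hpol_le].
      apply Rdiv_le_0_compat; [apply pow_le, Hv|apply INR_fact_lt_0].
    + rewrite <- scal_sum; apply Rmult_le_compat_l; [left; apply exp_pos|].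
      apply exp_ge_taylor, Rmult_le_pos; lra.
  - intros q.
    eapply is_Cseries_ext; [|exact (is_Cseries_scal _ _ _ (is_Cseries_hpol_l u x y q))].
    intros p; simpl; ring.
  - replace (u * x + v * y - u * v) with (u * x + v * (y - u)) by ring.
    rewrite Cexp_plus.
    eapply is_Cseries_ext; [|exact (is_Cseries_scal _ _ _
      (is_Cseries_exp_scaled v (y - u) _ (fun q => eq_refl)))].
    intros q; simpl; ring.
Qed.

Theorem proposition3p4 (u v z : C) :
  (forall q : nat,
     is_Cseries (fun p : nat => u ^ p / RtoC (INR (fact p)) * Hermite p q z)
                ((Cconj z - u) ^ q * Cexp (u * z)))
  /\
  (forall p : nat,
     is_Cseries (fun q : nat => v ^ q / RtoC (INR (fact q)) * Hermite p q z)
                ((z - v) ^ p * Cexp (v * Cconj z)))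
  /\
  is_Cdouble_series
    (fun p q : nat =>
       u ^ p / RtoC (INR (fact p)) * (v ^ q / RtoC (INR (fact q))) * Hermite p q z)
    (Cexp (u * z + v * Cconj z - u * v)).
Proof.
  (* [Hermite] occurs under binders, so it is replaced as a whole function by extensionality. *)
  replace Hermite with (fun p q z => hpol p q z (Cconj z)).
  2:{ do 3 (apply functional_extensionality; intros ?); symmetry; apply Hermite_hpol. }
  split; [|split].
  - apply is_Cseries_hpol_l.
  - apply is_Cseries_hpol_r.
  - apply is_Cdouble_series_hpol.
Qed.
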